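(* Let the balancing scheme be any of AVL trees, red-black trees, weight-balanced trees or treaps, and let $T_p$ (pivot) and $T_d$ (decomposed) be two balanced BSTs, with $m=\min(|T_p|,|T_d|)$ and $n=\max(|T_p|,|T_d|)$. The split work in $\mathrm{union}$, $\mathrm{intersect}$ and $\mathrm{difference}$ (algorithms in the context) on these two trees, i.e. $\sum_{v\in T_p}\left(\log(|T_d(v)|+1)+1\right)$ restricted to nodes that perform a split, is $O\left(m\log\left(\frac{n}{m}+1\right)\right)$ (in expectation for treaps).
   Context: A binary tree is either $\mathrm{Leaf}$ or $\mathrm{Node}(L,k,R)$; $\mathrm{expose}(\mathrm{Node}(L,k,R))=(L,k,R)$; size $|T|$, weight $w(T)=|T|+1$, height $h(T)$. A BST has keys from a total order with strictly increasing in-order sequence. Schemes: AVL (children heights differ by at most one); red-black (nodes red/black, leaves black, no red node has a red child, equal black counts on all downward paths to leaves, root may be red); $\alpha$ weight-balanced with $\frac2{11}<\alpha\le 1-\frac1{\sqrt2}$ (every $T=\mathrm{Node}(L,v,R)$ has $\alpha\le w(L)/w(T)\le1-\alpha$); treaps (independent uniformly random priorities, heap-ordered with highest priority at the root). $\mathrm{split}(T,k)$ is the generic algorithm that searches for $k$ and rejoins the subtrees hanging off the search path with the scheme's $\mathrm{join}$; it returns $(T_l,b,T_r)$ with the keys of $T$ less than $k$, a flag for $k\in T$, and the keys greater than $k$, and costs $O(\log|T|+1)$ work. $\mathrm{union}(T_1,T_2)$: if $T_1=\mathrm{Leaf}$ return $T_2$; if $T_2=\mathrm{Leaf}$ return $T_1$;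 $(L_2,k_2,R_2)=\mathrm{expose}(T_2)$; $(L_1,b,R_1)=\mathrm{split}(T_1,k_2)$; in parallel $T_l=\mathrm{union}(L_1,L_2)$, $T_r=\mathrm{union}(R_1,R_2)$; return $\mathrm{join}(T_l,k_2,T_r)$. $\mathrm{intersect}$ (returns Leaf if either argument is Leaf; combines with $\mathrm{join}$ if $b$ is true, else $\mathrm{join2}$) and $\mathrm{difference}$ (returns Leaf if $T_1$ is Leaf, $T_1$ if $T_2$ is Leaf; combines with $\mathrm{join2}$) perform exactly the same splits and recursive calls, with $\mathrm{join2}$ concatenating two trees without a middle key. The first argument $T_1$ is the decomposed tree, the second $T_2$ the pivot tree. For a node $v$ of the top-level pivot tree $T_p$, $T_d(v)$ is the first argument of the recursive call whose second argument is the subtree of $T_p$ rooted at $v$ (empty if no such call occurs); the split work is the total work of all calls to $\mathrm{split}$. *)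

(* Defs.v *)
From HB Require Import structures.
From mathcomp Require Import all_boot all_order all_algebra.
From mathcomp Require Import all_classical all_reals all_analysis.

Set Implicit Arguments.
Unset Strict Implicit.
Unset Printing Implicit Defensive.
Import Order.TTheory GRing.Theory Num.Theory.
Import numFieldNormedType.Exports.
Local Open Scope classical_set_scope.
Local Open Scope ring_scope.

(* Nodes carry an annotation of type [A]: the colour for red-black trees,
   nothing ([A := unit]) for the other schemes.  Sizes and heights are
   recomputed rather than stored, and a treap priority is a function of the
   key. *)
Inductive tree (A K : Type) : Type :=
| Leaf
| Node of tree A K & A & K & tree A K.

Arguments Leaf {A K}.

Fixpoint tree_size {A K : Type} (T : tree A K) : nat :=
  if T is Node L _ _ R then (tree_size L + tree_size R).+1 else 0%N.

Definition weight {A K : Type} (T : tree A K) : nat := (tree_size T).+1.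

Fixpoint height {A K : Type} (T : tree A K) : nat :=
  if T is Node L _ _ R then (maxn (height L) (height R)).+1 else 0%N.

Fixpoint inorder {A K : Type} (T : tree A K) : seq K :=
  if T is Node L _ k R then inorder L ++ k :: inorder R else [::].

Definition is_leaf {A K : Type} (T : tree A K) : bool :=
  if T is Leaf then true else false.

Definition bst {A : Type} {d : Order.disp_t} {K : orderType d} (T : tree A K) :
  bool := sorted <%O (inorder T).

Definition rotate_left {A K : Type} (T : tree A K) : tree A K :=
  if T is Node l a k (Node l' a' k' r') then Node (Node l a k l') a' k' r'
  else T.

Definition rotate_right {A K : Type} (T : tree A K) : tree A K :=
  if T is Node (Node l' a' k' r') a k r then Node l' a' k' (Node r' a k r)
  else T.

Fixpoint avl {K : Type} (T : tree unit K) : bool :=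
  if T is Node L _ _ R then
    [&& (height L <= (height R).+1)%N, (height R <= (height L).+1)%N,
        avl L & avl R]
  else true.

Fixpoint avl_join_right {K : Type} (TL : tree unit K) (k : K)
    (TR : tree unit K) : tree unit K :=
  if TL is Node l _ k' c then
    if (height c <= (height TR).+1)%N then
      let T' := Node c tt k TR in
      if (height T' <= (height l).+1)%N then Node l tt k' T'
      else rotate_left (Node l tt k' (rotate_right T'))
    else
      let T' := avl_join_right c k TR in
      let T'' := Node l tt k' T' in
      if (height T' <= (height l).+1)%N then T'' else rotate_left T''
  else Node TL tt k TR.

Fixpoint avl_join_left {K : Type} (TL : tree unit K) (k : K)
    (TR : tree unit K) : tree unit K :=
  if TR is Node c _ k' r then
    if (height c <= (height TL).+1)%N then
      let T' := Node TL tt k c in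
      if (height T' <= (height r).+1)%N then Node T' tt k' r
      else rotate_right (Node (rotate_left T') tt k' r)
    else
      let T' := avl_join_left TL k c in
      let T'' := Node T' tt k' r in
      if (height T' <= (height r).+1)%N then T'' else rotate_right T''
  else Node TL tt k TR.

Definition avl_join {K : Type} (TL : tree unit K) (k : K) (TR : tree unit K) :
    tree unit K :=
  if ((height TR).+1 < height TL)%N then avl_join_right TL k TR
  else if ((height TL).+1 < height TR)%N then avl_join_left TL k TR
  else Node TL tt k TR.

Inductive color : Type := Red | Black.

Definition is_red_color (c : color) : bool := if c is Red then true else false.

Definition is_red {K : Type} (T : tree color K) : bool :=
  if T is Node _ c _ _ then is_red_color c else false.

(* The number of black nodes on each downward path from the root to a leaf,
   the (black) leaf included. *)
Fixpoint black_counts {K : Type} (T : tree color K) : seq nat :=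
  if T is Node L c _ R then
    [seq (~~ is_red_color c + n)%N | n <- black_counts L ++ black_counts R]
  else [:: 1%N].

Fixpoint no_red_red {K : Type} (T : tree color K) : bool :=
  if T is Node L c _ R then
    [&& is_red_color c ==> ~~ is_red L && ~~ is_red R,
        no_red_red L & no_red_red R]
  else true.

Definition red_black {K : Type} (T : tree color K) : bool :=
  no_red_red T && constant (black_counts T).

(* Read off the leftmost path; on a red-black tree all paths agree. *)
Fixpoint black_height {K : Type} (T : tree color K) : nat :=
  if T is Node L c _ _ then (~~ is_red_color c + black_height L)%N else 1%N.

Definition rb_rank {K : Type} (T : tree color K) : nat :=
  if is_red T then ((black_height T).*2 - 1)%N else (black_height T - 1).*2.

Definition paint_black {K : Type} (T : tree color K) : tree color K :=
  if T is Node l _ k r then Node l Black k r else T.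

Definition left_child {A K : Type} (T : tree A K) : tree A K :=
  if T is Node l _ _ _ then l else Leaf.

Definition right_child {A K : Type} (T : tree A K) : tree A K :=
  if T is Node _ _ _ r then r else Leaf.

Fixpoint rb_join_right {K : Type} (TL : tree color K) (k : K)
    (TR : tree color K) : tree color K :=
  if rb_rank TL == (rb_rank TR)./2.*2 then Node TL Red k TR
  else if TL is Node l c' k' r then
    let T' := rb_join_right r k TR in
    if [&& ~~ is_red_color c', is_red T' & is_red (right_child T')] then
      if T' is Node l1 c1 k1 r1 then
        rotate_left (Node l c' k' (Node l1 c1 k1 (paint_black r1)))
      else Node l c' k' T'
    else Node l c' k' T'
  else Node TL Red k TR.

Fixpoint rb_join_left {K : Type} (TL : tree color K) (k : K)
    (TR : tree color K) : tree color K :=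
  if rb_rank TR == (rb_rank TL)./2.*2 then Node TL Red k TR
  else if TR is Node l c' k' r then
    let T' := rb_join_left TL k l in
    if [&& ~~ is_red_color c', is_red T' & is_red (left_child T')] then
      if T' is Node l1 c1 k1 r1 then
        rotate_right (Node (Node (paint_black l1) c1 k1 r1) c' k' r)
      else Node T' c' k' r
    else Node T' c' k' r
  else Node TL Red k TR.

Definition rb_join {K : Type} (TL : tree color K) (k : K) (TR : tree color K) :
    tree color K :=
  if ((rb_rank TR)./2 < (rb_rank TL)./2)%N then
    let T' := rb_join_right TL k TR in
    if is_red T' && is_red (right_child T') then paint_black T' else T'
  else if ((rb_rank TL)./2 < (rb_rank TR)./2)%N then
    let T' := rb_join_left TL k TR in
    if is_red T' && is_red (left_child T') then paint_black T' else T'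
  else if ~~ is_red TL && ~~ is_red TR then Node TL Red k TR
  else Node TL Black k TR.

Fixpoint weight_balanced {R : realFieldType} {K : Type} (alpha : R)
    (T : tree unit K) : bool :=
  if T is Node l _ _ r then
    [&& alpha <= (weight l)%:R / (weight T)%:R <= 1 - alpha,
        weight_balanced alpha l & weight_balanced alpha r]
  else true.

(* Siblings of weights [a] and [b] satisfy the balance condition: the weight
   of a node is the sum of the weights of its children. *)
Definition wb_like {R : realFieldType} (alpha : R) (a b : nat) : bool :=
  alpha <= a%:R / (a + b)%:R <= 1 - alpha.

Fixpoint wb_join_right {R : realFieldType} {K : Type} (alpha : R)
    (TL : tree unit K) (k : K) (TR : tree unit K) : tree unit K :=
  if TL is Node l _ k' c then
    if wb_like alpha (weight TL) (weight TR) then Node TL tt k TR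
    else
      let T' := wb_join_right alpha c k TR in
      let l1 := left_child T' in
      let r1 := right_child T' in
      if wb_like alpha (weight l) (weight T') then Node l tt k' T'
      else if wb_like alpha (weight l) (weight l1)
           && wb_like alpha (weight l + weight l1) (weight r1)
      then rotate_left (Node l tt k' T')
      else rotate_left (Node l tt k' (rotate_right T'))
  else Node TL tt k TR.

Fixpoint wb_join_left {R : realFieldType} {K : Type} (alpha : R)
    (TL : tree unit K) (k : K) (TR : tree unit K) : tree unit K :=
  if TR is Node c _ k' r then
    if wb_like alpha (weight TL) (weight TR) then Node TL tt k TR
    else
      let T' := wb_join_left alpha TL k c in
      let l1 := left_child T' in
      let r1 := right_child T' in
      if wb_like alpha (weight T') (weight r) then Node T' tt k' r
      else if wb_like alpha (weight r1) (weight r)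
           && wb_like alpha (weight l1) (weight r1 + weight r)
      then rotate_right (Node T' tt k' r)
      else rotate_right (Node (rotate_left T') tt k' r)
  else Node TL tt k TR.

Definition wb_join {R : realFieldType} {K : Type} (alpha : R)
    (TL : tree unit K) (k : K) (TR : tree unit K) : tree unit K :=
  if wb_like alpha (weight TL) (weight TR) then Node TL tt k TR
  else if (weight TR < weight TL)%N then wb_join_right alpha TL k TR
  else wb_join_left alpha TL k TR.

Fixpoint heap_ordered {R : realFieldType} {K : Type} (prio : K -> R)
    (T : tree unit K) : bool :=
  if T is Node L _ k R then
    [&& all (fun x => prio x <= prio k) (inorder L ++ inorder R),
        heap_ordered prio L & heap_ordered prio R]
  else true.

(* [k] has at least the priority of the root of [T], if there is one. *)
Definition prior {R : realFieldType} {K : Type} (prio : K -> R) (k : K)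
    (T : tree unit K) : bool :=
  if T is Node _ _ k' _ then prio k' <= prio k else true.

Fixpoint treap_join {R : realFieldType} {K : Type} (prio : K -> R)
    (TL : tree unit K) (k : K) : tree unit K -> tree unit K :=
  fix join_TL (TR : tree unit K) : tree unit K :=
    if prior prio k TL && prior prio k TR then Node TL tt k TR
    else match TL, TR with
    | Node l1 _ k1 r1, Node l2 _ k2 r2 =>
        if prio k2 <= prio k1 then Node l1 tt k1 (treap_join prio r1 k TR)
        else Node (join_TL l2) tt k2 r2
    | Node l1 _ k1 r1, Leaf => Node l1 tt k1 (treap_join prio r1 k TR)
    | Leaf, Node l2 _ k2 r2 => Node (join_TL l2) tt k2 r2
    | Leaf, Leaf => Node TL tt k TR
    end.

Fixpoint tsplit {A : Type} {d : Order.disp_t} {K : orderType d}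
    (join : tree A K -> K -> tree A K -> tree A K) (T : tree A K) (k : K) :
    tree A K * bool * tree A K :=
  if T is Node L _ m R then
    if k == m then (L, true, R)
    else if (k < m)%O then
      let: (LL, b, LR) := tsplit join L k in (LL, b, join LR m R)
    else
      let: (RL, b, RR) := tsplit join R k in (join L m RL, b, RR)
  else (Leaf, false, Leaf).

(* [split_last join L k R] removes the last key of the tree [Node L _ k R]. *)
Fixpoint split_last {A K : Type}
    (join : tree A K -> K -> tree A K -> tree A K)
    (L : tree A K) (k : K) (R : tree A K) : tree A K * K :=
  if R is Node L' _ k' R' then
    let: (T', last) := split_last join L' k' R' in (join L k T', last)
  else (L, k).

Definition join2 {A K : Type} (join : tree A K -> K -> tree A K -> tree A K)
    (TL TR : tree A K) : tree A K :=
  if TL is Node L _ k R then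
    let: (TL', last) := split_last join L k R in join TL' last TR
  else TR.

(* The set operations return, besides their result, the arguments of all the
   calls to [tsplit] they make.  The call [(T1, k2)] is made at the node [v] of
   the pivot tree that carries [k2], and [T1] is then T_d(v). *)
Fixpoint tunion {A : Type} {d : Order.disp_t} {K : orderType d}
    (join : tree A K -> K -> tree A K -> tree A K) (T1 T2 : tree A K)
    {struct T2} : tree A K * seq (tree A K * K) :=
  match T1, T2 with
  | Leaf, _ => (T2, [::])
  | _, Leaf => (T1, [::])
  | _, Node L2 _ k2 R2 =>
      let: (L1, _, R1) := tsplit join T1 k2 in
      let: (Tl, callsl) := tunion join L1 L2 in
      let: (Tr, callsr) := tunion join R1 R2 in
      (join Tl k2 Tr, (T1, k2) :: callsl ++ callsr)
  end.

Fixpoint tintersect {A : Type} {d : Order.disp_t} {K : orderType d}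
    (join : tree A K -> K -> tree A K -> tree A K) (T1 T2 : tree A K)
    {struct T2} : tree A K * seq (tree A K * K) :=
  match T1, T2 with
  | Leaf, _ => (Leaf, [::])
  | _, Leaf => (Leaf, [::])
  | _, Node L2 _ k2 R2 =>
      let: (L1, b, R1) := tsplit join T1 k2 in
      let: (Tl, callsl) := tintersect join L1 L2 in
      let: (Tr, callsr) := tintersect join R1 R2 in
      (if b then join Tl k2 Tr else join2 join Tl Tr,
       (T1, k2) :: callsl ++ callsr)
  end.

Fixpoint tdifference {A : Type} {d : Order.disp_t} {K : orderType d}
    (join : tree A K -> K -> tree A K -> tree A K) (T1 T2 : tree A K)
    {struct T2} : tree A K * seq (tree A K * K) :=
  match T1, T2 with
  | Leaf, _ => (Leaf, [::])
  | _, Leaf => (T1, [::])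
  | _, Node L2 _ k2 R2 =>
      let: (L1, _, R1) := tsplit join T1 k2 in
      let: (Tl, callsl) := tdifference join L1 L2 in
      let: (Tr, callsr) := tdifference join R1 R2 in
      (join2 join Tl Tr, (T1, k2) :: callsl ++ callsr)
  end.

Inductive set_operation : Type := Union | Intersect | Difference.

Definition run {A : Type} {d : Order.disp_t} {K : orderType d}
    (op : set_operation) (join : tree A K -> K -> tree A K -> tree A K)
    (T1 T2 : tree A K) : tree A K * seq (tree A K * K) :=
  match op with
  | Union => tunion join T1 T2
  | Intersect => tintersect join T1 T2
  | Difference => tdifference join T1 T2
  end.

Definition log2 {R : realType} (x : R) : R := ln x / ln 2.

Definition split_cost {R : realType} {A K : Type} (T : tree A K) : R :=
  log2 ((tree_size T)%:R + 1) + 1.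

Definition split_work {R : realType} {A : Type} {d : Order.disp_t}
    {K : orderType d} (op : set_operation)
    (join : tree A K -> K -> tree A K -> tree A K) (Td Tp : tree A K) : R :=
  \sum_(call <- (run op join Td Tp).2) split_cost call.1.

(* For m = 0 this is 0, as is then the split work. *)
Definition work_bound {R : realType} (sp sd : nat) : R :=
  let m : R := (minn sp sd)%:R in
  let n : R := (maxn sp sd)%:R in
  m * log2 (n / m + 1).

(* A node is named by the path leading to it ([false]: left). *)
Fixpoint nodes {A K : Type} (T : tree A K) : seq (seq bool) :=
  if T is Node L _ _ R then
    [::] :: map (cons false) (nodes L) ++ map (cons true) (nodes R)
  else [::].

(* T_d(v) *)
Fixpoint decomposed_at {A : Type} {d : Order.disp_t} {K : orderType d}
    (join : tree A K -> K -> tree A K -> tree A K) (T1 T2 : tree A K)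
    (v : seq bool) {struct v} : tree A K :=
  if v is b :: v' then
    match T1, T2 with
    | Node _ _ _ _, Node L2 _ k2 R2 =>
        let: (L1, _, R1) := tsplit join T1 k2 in
        if b then decomposed_at join R1 R2 v' else decomposed_at join L1 L2 v'
    | _, _ => Leaf
    end
  else T1.

Lemma split_workE {R : realType} {A : Type} {d : Order.disp_t}
    {K : orderType d} (op : set_operation)
    (join : tree A K -> K -> tree A K -> tree A K) (Td Tp : tree A K) :
  split_work op join Td Tp =
  \sum_(v <- nodes Tp | ~~ is_leaf (decomposed_at join Td Tp v))
     split_cost (decomposed_at join Td Tp v) :> R.
Proof.
rewrite /split_work.
have Leaf0 T2 v : is_leaf (decomposed_at join Leaf T2 v) by case: v.
elim: Tp Td => [|L2 IHL c k2 R2 IHR] Td.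
  by case: op; case: Td => [|? ? ? ?] /=; rewrite !big_nil.
case: Td => [|l a k r].
  rewrite [RHS]big_pred0 => [|v]; last by rewrite Leaf0.
  by case: op {IHL IHR} => /=; rewrite big_nil.
have -> : (run op join (Node l a k r) (Node L2 c k2 R2)).2 =
    (Node l a k r, k2) ::
    (run op join (tsplit join (Node l a k r) k2).1.1 L2).2 ++
    (run op join (tsplit join (Node l a k r) k2).2 R2).2.
  rewrite /run; case: op {IHL IHR}; rewrite [in LHS]/=;
  rewrite -![if k2 == k then _ else _]/(tsplit join (Node l a k r) k2);
  case: (tsplit _ _ _) => -[L1 b] R1 /=;
  [case: (tunion _ L1 _) => ? ?; case: (tunion _ R1 _)
  |case: (tintersect _ L1 _) => ? ?; case: (tintersect _ R1 _)
  |case: (tdifference _ L1 _) => ? ?; case: (tdifference _ R1 _)] => ? ? //.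
rewrite big_cons big_cat [nodes _]/= big_cons /=.
congr (_ + _); rewrite big_cat !big_map IHL IHR /=.
case: (if k2 == k then _ else _) => -[L1 b] R1 /=.
by congr (_ + _).
Qed.

Definition mutually_independent {R : realType} {d : measure_display}
    {Omega : measurableType d} {K : eqType} (P : probability Omega R)
    (ks : seq K) (X : K -> Omega -> R) : Prop :=
  forall (s : seq K) (B : K -> set R),
    uniq s -> {subset s <= ks} -> (forall k, measurable (B k)) ->
    P (\bigcap_(k in [set` s]) (X k @^-1` B k)) =
    (\prod_(k <- s) fine (P (X k @^-1` B k)))%:E.

Definition iid_uniform_priorities {R : realType} {d : measure_display}
    {Omega : measurableType d} {K : eqType} (P : probability Omega R)
    (ks : seq K) (prio : K -> {RV P >-> R}) : Prop :=
  (forall (k : K) (B : set R), k \in ks -> measurable B ->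
     distribution P (prio k) B = uniform_prob (@ltr01 R) B) /\
  mutually_independent P ks (fun k => prio k).

(* [T] is a tree-valued random variable (measurable for the discrete
   sigma-algebra; its range is finite) whose value is always a treap with the
   keys [ks] for the priorities drawn.  The treap is unique unless two
   priorities coincide, which has probability 0. *)
Definition random_treap {R : realType} {d : measure_display}
    {Omega : measurableType d} {d' : Order.disp_t} {K : orderType d'}
    (P : probability Omega R) (ks : seq K) (prio : K -> {RV P >-> R})
    (T : Omega -> tree unit K) : Prop :=
  (forall t : tree unit K, measurable (T @^-1` [set t])) /\
  (forall w : Omega,
     [/\ bst (T w), inorder (T w) = ks & heap_ordered (prio ^~ w) (T w)]).

(* Main.v *)
Require Import Defs.
From HB Require Import structures.
From mathcomp Require Import all_boot all_order all_algebra.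
From mathcomp Require Import all_classical all_reals all_analysis.
From mathcomp Require Import measurable_realfun.
From mathcomp Require Import ring lra zify.
Import Order.TTheory GRing.Theory Num.Theory.
Local Open Scope ring_scope.

(* Every [join] preserves the in-order sequence, so T_d(v) holds exactly the
   decomposed keys in the key interval of [v]: only the shape of the pivot tree
   and the key sets matter, and the balance of T_d is irrelevant.

   Distribute the p nodes of the pivot tree into layers such that layer i has
   O(p / b^i) nodes (b > 1) and the sets T_d(v), v in layer i, have total size
   O(q).  The cost log(x+1) + 1 is concave, so in layer i it is dominated by an
   affine function a_i + b_i x, and suitable tangents make the sum over the
   layers geometric apart from O(log(p/q + 1)) layers costing O(q) each.

   For AVL, red-black and weight-balanced trees the layer of a node is its
   height: a balanced tree of height h has weight at least b^h, and nodes of the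
   same height have disjoint subtrees.  For treaps, layer i consists of the
   nodes with priority about 1 - 2^-i.  A key x is in T_d(k) only if [k] has the
   highest priority among the pivot keys between [k] and x; with j such keys and
   [k] in layer i this has probability at most 2^-i (1 - 2^-(i+1))^j, which sums
   to O(1) over [k], so both layer bounds hold in expectation. *)

(** * In-order sequences of joins and splits *)

Lemma inorder_rotate_left {A K : Type} (T : tree A K) :
  inorder (rotate_left T) = inorder T.
Proof. by case: T => // l a k [] //= l' a' k' r'; rewrite -catA. Qed.

Lemma inorder_rotate_right {A K : Type} (T : tree A K) :
  inorder (rotate_right T) = inorder T.
Proof. by case: T => // -[] //= l' a' k' r' a k r; rewrite -catA. Qed.

Lemma inorder_paint_black {K : Type} (T : tree color K) :
  inorder (paint_black T) = inorder T.
Proof. by case: T. Qed.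

#[local] Arguments rotate_left : simpl never.
#[local] Arguments rotate_right : simpl never.

Lemma inorder_avl_join {K : Type} (TL : tree unit K) (k : K)
    (TR : tree unit K) :
  inorder (avl_join TL k TR) = inorder TL ++ k :: inorder TR.
Proof.
have joinr : inorder (avl_join_right TL k TR) = inorder TL ++ k :: inorder TR.
  elim: TL => [|l _ a k' c IH] //=.
  by do 2?case: ifP => _; rewrite ?inorder_rotate_left /= ?inorder_rotate_right
    /= ?IH -?catA.
have joinl : inorder (avl_join_left TL k TR) = inorder TL ++ k :: inorder TR.
  elim: {joinr} TR => [|c IH a k' r _] //=.
  by do 2?case: ifP => _; rewrite ?inorder_rotate_right /= ?inorder_rotate_left
    /= ?IH -?catA.
by rewrite /avl_join; do 2?case: ifP => _ //.
Qed.

Lemma inorder_rb_join {K : Type} (TL : tree color K) (k : K)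
    (TR : tree color K) :
  inorder (rb_join TL k TR) = inorder TL ++ k :: inorder TR.
Proof.
have joinr : inorder (rb_join_right TL k TR) = inorder TL ++ k :: inorder TR.
  elim: TL => [|l _ a k' c IH]; rewrite [rb_join_right _ _ _]/=.
    by case: ifP.
  case: ifP => // _; case: ifP => _; last by rewrite /= IH -catA.
  case: (rb_join_right c k TR) IH => [|l1 c1 k1 r1] IH; first by rewrite /= -catA /= -IH.
  by rewrite inorder_rotate_left /= inorder_paint_black -catA /= -IH.
have joinl : inorder (rb_join_left TL k TR) = inorder TL ++ k :: inorder TR.
  elim: {joinr} TR => [|c IH a k' r _]; rewrite [rb_join_left _ _ _]/=.
    by case: ifP.
  case: ifP => // _; case: ifP => _; last by rewrite /= IH -catA.
  case: (rb_join_left TL k c) IH => [|l1 c1 k1 r1] IH; first by rewrite -cat_cons catA -IH.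
  by rewrite inorder_rotate_right /= inorder_paint_black -cat_cons catA -IH -catA.
by rewrite /rb_join; do 4?case: ifP => _ //; rewrite ?inorder_paint_black.
Qed.

Lemma inorder_wb_join {R : realFieldType} {K : Type} (alpha : R)
    (TL : tree unit K) (k : K) (TR : tree unit K) :
  inorder (wb_join alpha TL k TR) = inorder TL ++ k :: inorder TR.
Proof.
have joinr :
    inorder (wb_join_right alpha TL k TR) = inorder TL ++ k :: inorder TR.
  elim: TL => [|l _ a k' c IH] //=.
  by do 4?case: ifP => _ //; rewrite ?inorder_rotate_left /= ?inorder_rotate_right
    /= ?IH -?catA.
have joinl :
    inorder (wb_join_left alpha TL k TR) = inorder TL ++ k :: inorder TR.
  elim: {joinr} TR => [|c IH a k' r _] //=.
  by do 4?case: ifP => _ //; rewrite ?inorder_rotate_right /= ?inorder_rotate_left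
    /= ?IH -?catA.
by rewrite /wb_join; do 2?case: ifP => _ //.
Qed.

(** Each call descends into only one of the two trees, hence an induction on [TR] nested in one on
    [TL]. *)
Lemma inorder_treap_join {R : realFieldType} {K : Type} (prio : K -> R)
    (TL : tree unit K) (k : K) (TR : tree unit K) :
  inorder (treap_join prio TL k TR) = inorder TL ++ k :: inorder TR.
Proof.
elim: TL TR => [|l1 _ a1 k1 r1 IHr] TR.
  elim: TR => [|l2 IHl a2 k2 r2 _] //=.
  by case: ifP => //= _; rewrite -/(treap_join prio Leaf k l2) IHl.
elim: TR => [|l2 IHl a2 k2 r2 _] /=.
  by case: ifP => //= _; rewrite IHr -catA.
do 2?case: ifP => //= _; first by rewrite IHr -catA.
by rewrite -/(treap_join prio (Node l1 a1 k1 r1) k l2) IHl /= -!catA.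
Qed.

Lemma sorted_node {A : Type} {d : Order.disp_t} {K : orderType d}
    (L : tree A K) (a : A) (k : K) (R : tree A K) :
  bst (Node L a k R) ->
  [/\ bst L, bst R, {in inorder L, forall x, (x < k)%O}
    & {in inorder R, forall x, (k < x)%O}].
Proof.
rewrite /bst /= !(sorted_pairwise lt_trans) pairwise_cat allrel_consr /=.
case/and3P => /andP[/allP ltL _] pL /andP[/allP gtR pR].
by split.
Qed.

Lemma filter_in_pred0 {T : eqType} (P : pred T) (s : seq T) :
  {in s, forall x, ~~ P x} -> [seq x <- s | P x] = [::].
Proof.
by move=> h; apply/eqP; rewrite -[_ == _]negbK -has_filter -all_predC; apply/allP.
Qed.

Lemma tsplit_inorder {A : Type} {d : Order.disp_t} {K : orderType d}
    (join : tree A K -> K -> tree A K -> tree A K) (T : tree A K) (k : K) :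
  (forall L m R, inorder (join L m R) = inorder L ++ m :: inorder R) ->
  bst T ->
  inorder (tsplit join T k).1.1 = [seq x <- inorder T | (x < k)%O] /\
  inorder (tsplit join T k).2 = [seq x <- inorder T | (k < x)%O].
Proof.
move=> joinE; elim: T => [|L IHL a m R IHR] //= bstT.
have [bL bR ltL gtR] := sorted_node _ _ _ _ bstT.
have keep (s : seq K) (P : pred K) :
    {in s, forall x, P x} -> [seq x <- s | P x] = s.
  by move=> h; apply/all_filterP/allP.
rewrite !filter_cat /=.
case: ltgtP => [km|mk|->] /=.
- have [IH1 IH2] := IHL bL.
  case: (tsplit join L k) IH1 IH2 => -[LL b] LR /= -> E; split.
    rewrite (filter_in_pred0 _ (inorder R)) ?cats0 // => x /gtR mx.
    by rewrite -leNgt (ltW (lt_trans km mx)).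
  rewrite joinE E (keep (inorder R)) // => x /gtR mx; exact: lt_trans mx.
- have [IH1 IH2] := IHR bR.
  case: (tsplit join R k) IH1 IH2 => -[RL b] RR /= E ->; split.
    rewrite joinE E (keep (inorder L)) // => x /ltL xm; exact: lt_trans mk.
  rewrite (filter_in_pred0 _ (inorder L)) // => x /ltL xm.
  by rewrite -leNgt (ltW (lt_trans xm mk)).
- split.
    rewrite (keep (inorder L)) // (filter_in_pred0 _ (inorder R)) ?cats0 // => x /gtR mx.
    by rewrite -leNgt ltW.
  rewrite (filter_in_pred0 _ (inorder L)) ?(keep (inorder R)) // => x /ltL xm.
  by rewrite -leNgt ltW.
Qed.

(** * Split work as a sum over the pivot tree and key lists *)

Lemma size_inorder {A K : Type} (T : tree A K) :
  size (inorder T) = tree_size T.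
Proof. by elim: T => //= L <- a k R <-; rewrite size_cat addnS. Qed.

(** The recursion of the set operations, with each decomposed tree replaced by its key list [s]. An
    empty list makes no call, hence the 0. [F] receives both the height and the key of a node, since
    layers are defined by height for balanced pivots and by key for treaps. *)
Fixpoint node_sum {R : realType} {A : Type} {d : Order.disp_t}
    {K : orderType d} (F : nat -> K -> nat -> R) (T : tree A K) (s : seq K) :
    R :=
  if T is Node L _ k T' then
    (if nilp s then 0 else F (height T) k (size s)) +
    (node_sum F L [seq x <- s | (x < k)%O] +
     node_sum F T' [seq x <- s | (k < x)%O])
  else 0.

Lemma node_sum_nil {R : realType} {A : Type} {d : Order.disp_t}
    {K : orderType d} (F : nat -> K -> nat -> R) (T : tree A K) :
  node_sum F T [::] = 0.
Proof. by elim: T => [|L IHL a k T' IHR] //=; rewrite IHL IHR !addr0. Qed.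

Lemma ler_node_sum {R : realType} {A : Type} {d : Order.disp_t}
    {K : orderType d} (F G : nat -> K -> nat -> R) (T : tree A K) (s : seq K) :
  (forall h k n, (0 < n)%N -> F h k n <= G h k n) ->
  node_sum F T s <= node_sum G T s.
Proof.
move=> FG; elim: T s => [|L IHL a k T' IHR] s //=.
apply: lerD; last exact: lerD.
by case: s => //= x s; apply: FG.
Qed.

(** The cost of a call depends on [T_d(v)] only through its number of keys, and these are cut out of
    the sorted list by the pivot keys above [v]. The shape of [Td] and the choice of [op] drop
    out. *)
Lemma split_work_node_sum {R : realType} {A : Type} {d : Order.disp_t}
    {K : orderType d} (op : set_operation)
    (join : tree A K -> K -> tree A K -> tree A K) (Td Tp : tree A K) :
  (forall L m T, inorder (join L m T) = inorder L ++ m :: inorder T) ->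
  bst Td ->
  split_work op join Td Tp =
  node_sum (fun _ _ n => log2 (n%:R + 1) + 1) Tp (inorder Td) :> R.
Proof.
move=> joinE; rewrite split_workE.
have Leaf0 T2 v : is_leaf (decomposed_at join Leaf T2 v) by case: v.
elim: Tp Td => [|L2 IHL c k2 R2 IHR] Td bTd; first by rewrite /= big_nil.
case: Td bTd => [|l a k r] bTd.
  rewrite node_sum_nil big_pred0 // => v; by rewrite Leaf0.
have [E1 E2] := tsplit_inorder _ _ k2 joinE bTd.
have bst1 : bst (tsplit join (Node l a k r) k2).1.1.
  by rewrite /bst E1 sorted_filter //; exact: lt_trans.
have bst2 : bst (tsplit join (Node l a k r) k2).2.
  by rewrite /bst E2 sorted_filter //; exact: lt_trans.
rewrite [nodes _]/= big_cons big_cat !big_map [node_sum _ _ _]/=.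
rewrite -/(inorder (Node l a k r)) -E1 -E2 -IHL // -IHR //.
have -> : nilp (inorder (Node l a k r)) = false.
  by rewrite /nilp size_inorder.
rewrite /= -/(inorder (Node l a k r)) /split_cost -size_inorder; congr (_ + _).
by case: (if k2 == k then _ else _) => -[L1 b] R1 /=.
Qed.

(** * Logarithm estimates, tangents and the sum over layers *)

Section Log2.
Variable R : realType.
Implicit Types x y : R.

Lemma ln2_gt0 : 0 < ln 2 :> R.
Proof. by rewrite ln_gt0 // ltr1n. Qed.

(** This is [ln (1 + x) <= x] at [x = -1/2]. *)
Lemma ln2_ge_half : 2^-1 <= ln 2 :> R.
Proof.
have : ln (1 + - 2^-1) <= - 2^-1 :> R by apply: le_ln1Dx; lra.
have -> : 1 + - 2^-1 = 2^-1 :> R by lra.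
by rewrite lnV ?posrE // lerN2.
Qed.

Lemma log2_2 : log2 2 = 1 :> R.
Proof. by rewrite /log2 divff // gt_eqF // ln2_gt0. Qed.

Lemma log2M x y : 0 < x -> 0 < y -> log2 (x * y) = log2 x + log2 y.
Proof. by move=> x0 y0; rewrite /log2 lnM ?posrE // mulrDl. Qed.

Lemma log2Xn x n : 0 < x -> log2 (x ^+ n) = n%:R * log2 x.
Proof. by move=> x0; rewrite /log2 lnXn // -[_ *+ n]mulr_natl mulrA. Qed.

Lemma ler_log2 x y : 0 < x -> x <= y -> log2 x <= log2 y.
Proof.
move=> x0 xy; rewrite /log2 ler_pM2r ?invr_gt0 ?ln2_gt0 //.
by rewrite ler_ln // posrE // (lt_le_trans x0).
Qed.

Lemma log2_ge0 x : 1 <= x -> 0 <= log2 x.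
Proof. by move=> x1; apply: divr_ge0; [exact: ln_ge0 | exact/ltW/ln2_gt0]. Qed.

(** The 2 bounds [1 / ln 2]. *)
Lemma log2_1D_le x : 0 <= x -> log2 (1 + x) <= 2 * x.
Proof.
move=> x0; have := @le_ln1Dx R x; have := ln2_ge_half => h /(_ ltac:(lra)) h'.
by rewrite /log2 ler_pdivrMr ?ln2_gt0 //; nra.
Qed.

Lemma log2_nat_le (n : nat) : log2 (n%:R + 1) <= n%:R :> R.
Proof.
rewrite -[leRHS]mulr1 -[X in _ * X]log2_2 -log2Xn //; apply: ler_log2.
  by rewrite ltr_wpDl.
by rewrite -natrX natr1 ler_nat ltn_expl.
Qed.

Lemma log2_11_10 : log2 (11 / 10) <= 1 :> R.
Proof. by rewrite -[leRHS]log2_2; apply: ler_log2; lra. Qed.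

(** Since [(11/10)^8 >= 2]. It turns a number of layers into a logarithm. *)
Lemma log2_growth_ge : 1 <= 4 * log2 ((11 / 10) ^+ 2) :> R.
Proof.
rewrite -(log2Xn _ 4); last by rewrite exprn_gt0 //; lra.
by rewrite -[leLHS]log2_2; apply: ler_log2 => //; rewrite -exprM; lra.
Qed.

(* The tangent to the concave cost, at a call of size about [T]. *)
Lemma split_cost_tangent (n : nat) (T : R) : 1 <= T ->
  log2 (n%:R + 1) + 1 <= log2 T + 1 + 2 / T * n%:R.
Proof.
move=> T1; have T0 : 0 < T by lra.
have nT0 : 0 <= n%:R / T by rewrite divr_ge0 // ltW.
have h : log2 (n%:R + 1) <= log2 (T * (1 + n%:R / T)).
  apply: ler_log2; first by rewrite ltr_wpDl.
  by rewrite mulrDr mulrCA divff ?gt_eqF // !mulr1 addrC lerD2r.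
have := log2_1D_le _ nT0; rewrite log2M // in h; last by lra.
by rewrite [2 / T * _]mulrAC -[2 * _ / T]mulrA; lra.
Qed.

Lemma geometric_sum_le (r : R) (n : nat) : 0 <= r -> r < 1 ->
  \sum_(i < n) r ^+ i <= (1 - r)^-1.
Proof.
move=> r0 r1; have d0 : 0 < 1 - r by lra.
rewrite -[leRHS]mul1r ler_pdivlMr // mulrC.
have -> : (1 - r) * (\sum_(i < n) r ^+ i) = 1 - r ^+ n.
  by rewrite -opprB mulNr -subrX1 opprB.
by have := exprn_ge0 n r0; lra.
Qed.

End Log2.

(* A layer [i] of the pivot tree holds about [p / g^(2 i)] nodes, which share
   the [q] decomposed keys.  Below layer [i0], where [g^(2 i0)] is about [p / q], a
   call is charged to its keys; above, the tangent is taken at the size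
   expected in the layer, but growing only like [g^i], so that both sums over
   the layers are geometric. *)
Lemma layered_work_bound (R : realType) (g := 11 / 10 : R) :
  exists c : R, 0 <= c /\ forall p q : nat, (0 < p)%N -> (0 < q)%N ->
  exists a b : nat -> R,
    [/\ forall i, 0 <= a i, forall i, 0 <= b i,
        forall i n, (0 < n)%N -> log2 (n%:R + 1) + 1 <= a i + b i * n%:R
      & forall H, \sum_(i < H) (a i * p%:R / g ^+ 2 ^+ i + b i * q%:R)
          <= c * work_bound p q].
Proof.
(* 252 = 2 * 5 + 22 * 11: the layers below [i0] cost [2 * i0 * q <= 10 * L * m], and the others form
   a series with factor [22 * L * m] and ratio 10/11, whose sum is at most 11. *)
exists 252%:R; split => [|p q p0 q0]; first by [].
have g0 : 0 < g by rewrite /g; lra.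
have P0 : 0 < p%:R :> R by rewrite ltr0n.
have Q0 : 0 < q%:R :> R by rewrite ltr0n.
(* Bernoulli's inequality for [g = 1 + 1/10], which lets [g ^+ j] absorb terms linear in [j]. *)
have bern (j : nat) : 10 + j%:R <= 10 * g ^+ j.
  elim: j => [|j IH]; first by rewrite expr0; lra.
  have : 0 <= j%:R :> R by [].
  by rewrite exprS -natr1; move: (g ^+ j) IH => y IH; rewrite /g; lra.
pose m : R := (minn p q)%:R; pose n : R := (maxn p q)%:R.
have m0 : 0 < m by rewrite ltr0n; lia.
pose L := log2 (n / m + 1).
have nm1 : 1 <= n / m by rewrite ler_pdivlMr // mul1r ler_nat; lia.
have L1 : 1 <= L by rewrite /L -[leLHS]log2_2; apply: ler_log2; lra.
have [i0 [i0p i0L]] : exists i0 : nat, p%:R / g ^+ 2 ^+ i0 <= m /\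
    i0%:R * q%:R <= 5 * L * m.
  have gi0 i : 0 < g ^+ 2 ^+ i by rewrite !exprn_gt0.
  have [pq|qp] := leqP p q.
    exists 0%N; split; first by rewrite expr0 divr1 /m (minn_idPl pq).
    by rewrite mul0r; nra.
  have ex : exists i, p%:R <= q%:R * g ^+ 2 ^+ i.
    exists (10 * p)%N; rewrite -exprM mulnC exprM.
    have h1 : 1 <= q%:R :> R by rewrite ler1n.
    have h2 : p%:R <= g ^+ (10 * p).
      have := bern (10 * p)%N; rewrite natrM; lra.
    have h3 : 1 <= g ^+ (10 * p) by rewrite exprn_ege1 // /g; lra.
    by rewrite expr2; nra.
  case: (ex_minnP ex) => i hi imin; exists i.
  have mE : m = q%:R by rewrite /m (minn_idPr (ltnW qp)).
  have nE : n = p%:R by rewrite /n (maxn_idPl (ltnW qp)).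
  split; first by rewrite mE ler_pdivrMr.
  rewrite mE ler_pM2r //.
  (* By minimality the predecessor [i] has [g^(2i) <= p / q], so [i <= 4 * L], and [1 <= L] pays for
     the last layer. *)
  case: i hi imin => [|i] hi imin; first by lra.
  have : log2 (g ^+ 2 ^+ i) <= L.
    apply: ler_log2 => //; rewrite mE nE.
    have : g ^+ 2 ^+ i <= p%:R / q%:R.
      rewrite ler_pdivlMr // mulrC ltW // ltNge; apply/negP => /imin.
      by rewrite ltnn.
    by lra.
  rewrite log2Xn ?exprn_gt0 //; have := log2_growth_ge R.
  rewrite -/g -natr1; have : 0 <= i%:R :> R by [].
  by nra.
(* The average number of keys per pivot node, but at least 1. In both cases [q / t = m]. *)
pose t : R := if (q <= p)%N then 1 else q%:R / p%:R.
have t1 : 1 <= t.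
  rewrite /t; case: leqP => // pq.
  by rewrite ler_pdivlMr // mul1r ler_nat ltnW.
have t0 : 0 < t by lra.
have qt : q%:R / t = m.
  rewrite /t /m; case: leqP => h; first by rewrite divr1.
  by rewrite invf_div mulrCA divff ?gt_eqF // mulr1.
have tL : log2 t <= L.
  apply: ler_log2 => //; rewrite /t; case: leqP => [_|pq]; first by lra.
  by rewrite /n /m (minn_idPl (ltnW pq)) (maxn_idPr (ltnW pq)); lra.
have lt0 : 0 <= log2 t by exact: log2_ge0.
(* Below [i0] the cost of a call with [n >= 1] keys is at most [2 * n]. From [i0] on the tangent is
   taken at [t * g ^+ (i - i0)], whose logarithm is at most [log2 t + (i - i0)]. *)
pose a i : R := if (i < i0)%N then 0 else log2 t + 1 + (i - i0)%:R.
pose b i : R := if (i < i0)%N then 2 else 2 / (t * g ^+ (i - i0)).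
have b0 i : 0 <= b i.
  rewrite /b; case: ifP => // _; rewrite divr_ge0 // mulr_ge0 ?ltW //.
  by rewrite exprn_gt0.
have a0 i : 0 <= a i.
  rewrite /a; case: ifP => // _; have : 0 <= (i - i0)%:R :> R by []; lra.
exists a, b; split => // [i k k0|H].
  rewrite /a /b; case: ltnP => _.
    have := log2_nat_le R k; have : 1 <= k%:R :> R by rewrite ler1n.
    by lra.
  set j := (i - i0)%N.
  have gj : 1 <= g ^+ j by rewrite exprn_ege1 // /g; lra.
  have T1 : 1 <= t * g ^+ j by nra.
  apply: le_trans (split_cost_tangent _ _ _ T1) _.
  rewrite log2M ?log2Xn ?exprn_gt0 // lerD2r.
  have := log2_11_10 R; rewrite -/g; have : 0 <= j%:R :> R by [].
  by nra.
apply: (@le_trans _ _ (\sum_(i < i0 + H) (a i * p%:R / g ^+ 2 ^+ i + b i * q%:R))).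
  rewrite addnC big_split_ord /= lerDl sumr_ge0 // => i _.
  by rewrite addr_ge0 // ?mulr_ge0 // invr_ge0 !exprn_ge0 // ltW.
rewrite big_split_ord /=.
have -> : \sum_(i < i0) (a i * p%:R / g ^+ 2 ^+ i + b i * q%:R) = 2 * (i0%:R * q%:R).
  rewrite (eq_bigr (fun=> 2 * q%:R)); last first.
    by move=> i _; rewrite /a /b ltn_ord !mul0r add0r.
  by rewrite sumr_const card_ord -mulr_natr; ring.
(* Of the decay [g^(-2j)], one factor [g^(-j)] absorbs the linear growth of [a], leaving
   [20 * L * m]; the other drives the series. The keys add [2 * m <= 2 * L * m]. *)
have hi : \sum_(j < H) (a (i0 + j)%N * p%:R / g ^+ 2 ^+ (i0 + j) + b (i0 + j)%N * q%:R)
    <= \sum_(j < H) (22 * L * m) * g^-1 ^+ j.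
  apply: ler_sum => j _; rewrite /a /b ltnNge leq_addr /= addKn.
  have gj0 : 0 < g ^+ j by rewrite exprn_gt0.
  have -> : 2 / (t * g ^+ j) * q%:R = 2 * m * g^-1 ^+ j.
    by rewrite -qt exprVn invfM; ring.
  have -> : (log2 t + 1 + j%:R) * p%:R / g ^+ 2 ^+ (i0 + j) =
      (p%:R / g ^+ 2 ^+ i0) * (log2 t + 1 + j%:R) / g ^+ j * g^-1 ^+ j.
    rewrite exprD invfM -[g ^+ 2 ^+ j]exprM mulnC exprM expr2 invfM exprVn; ring.
  rewrite -mulrDl ler_pM2r ?exprn_gt0 ?invr_gt0 //.
  have h1 : (log2 t + 1 + j%:R) / g ^+ j <= 20 * L.
    rewrite ler_pdivrMr //; have := bern j; have : 0 <= j%:R :> R by [].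
    have : 1 <= g ^+ j by rewrite exprn_ege1 // /g; lra.
    by nra.
  have h0 : 0 <= (log2 t + 1 + j%:R) / g ^+ j.
    by rewrite divr_ge0 ?ltW //; have : 0 <= j%:R :> R by []; lra.
  have h2 : 0 <= p%:R / g ^+ 2 ^+ i0 by rewrite divr_ge0 // !exprn_ge0 // ltW.
  have := ler_pM h2 h0 i0p h1; rewrite mulrA; nra.
rewrite -mulr_sumr in hi.
have := geometric_sum_le R g^-1 H; rewrite invr_ge0 ltW // => /(_ isT).
rewrite invf_lt1 // {1}/g => /(_ ltac:(lra)).
have -> : (1 - g^-1)^-1 = 11 by rewrite /g; field.
move=> hg; rewrite /work_bound -/m -/n -/L.
have Lm : 0 < L * m by rewrite mulr_gt0 //; lra.
by nra.
Qed.

(** * Pivot trees whose weight is exponential in their height *)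

Lemma weight_node {A K : Type} (L : tree A K) (a : A) (k : K) (T : tree A K) :
  weight (Node L a k T) = (weight L + weight T)%N.
Proof. by rewrite /weight /= addSn addnS. Qed.

Lemma ler_sum_ord_widen {R : realType} (F : nat -> R) (m n : nat) :
  (forall i, 0 <= F i) -> (m <= n)%N -> \sum_(i < m) F i <= \sum_(i < n) F i.
Proof.
move=> F0 /subnKC <-; rewrite big_split_ord /= lerDl.
by apply: sumr_ge0 => i _.
Qed.

Lemma size_filter_lt_gt {d : Order.disp_t} {K : orderType d} (s : seq K)
    (k : K) :
  (size [seq x <- s | (x < k)%O] + size [seq x <- s | (k < x)%O] <= size s)%N.
Proof. by elim: s => //= x s IH; case: ltgtP => //= _; lia. Qed.

Section BalancedPivot.
Context {R : realType} {A : Type} {d : Order.disp_t} {K : orderType d}.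
Variables (growth : R) (balanced : tree A K -> bool).
Hypothesis growth_gt0 : 0 < growth.
Hypothesis balanced_children : forall L a k T,
  balanced (Node L a k T) -> balanced L /\ balanced T.
Hypothesis balanced_weight : forall T,
  balanced T -> growth ^+ height T <= (weight T)%:R.

(* Nodes of the same height have disjoint subtrees and receive disjoint sets
   of keys. *)
Lemma node_sum_height_le (a b : nat -> R) (T : tree A K) (s : seq K) :
  (forall i, 0 <= a i) -> (forall i, 0 <= b i) -> balanced T ->
  node_sum (fun h _ n => a h + b h * n%:R) T s <=
  \sum_(i < (height T).+1)
     (a i * (weight T)%:R / growth ^+ i + b i * (size s)%:R).
Proof.
move=> a0 b0.
pose B w m H := \sum_(i < H) (a i * w%:R / growth ^+ i + b i * m%:R).
have term0 w m i : 0 <= a i * w%:R / growth ^+ i + b i * m%:R.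
  by rewrite addr_ge0 ?mulr_ge0 // invr_ge0 exprn_ge0 // ltW.
have Bmono w m H H' : (H <= H')%N -> B w m H <= B w m H'.
  exact: (ler_sum_ord_widen (fun i => a i * w%:R / growth ^+ i + b i * m%:R)).
rewrite -/(B _ _ _).
elim: T s => [|L IHL c k T IHT] s balT; first exact: sumr_ge0.
(* The root alone has height [h] and is charged to the top term, where [balanced_weight] makes the
   coefficient of [a h] at least 1. The children are charged to the terms below [h]. *)
have [balL balR] := balanced_children _ _ _ _ balT.
set h := height (Node L c k T); rewrite /B big_ord_recr /= -/h addrC.
apply: lerD.
  case: (nilp s); first exact: term0.
  rewrite lerD2r -mulrA ler_peMr // ler_pdivlMr ?exprn_gt0 // mul1r.
  exact: balanced_weight.
set sl := [seq _ <- s | _]; set sr := [seq _ <- s | _].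
apply: (@le_trans _ _ (B (weight L) (size sl) h + B (weight T) (size sr) h)).
  apply: lerD.
    apply: le_trans (IHL sl balL) _; apply: Bmono.
    by rewrite /h /=; lia.
  apply: le_trans (IHT sr balR) _; apply: Bmono.
  by rewrite /h /=; lia.
rewrite /B -big_split /=; apply: ler_sum => i _.
rewrite addrACA; apply: lerD.
  by rewrite -!mulrA -mulrDr -mulrDl -natrD weight_node.
by rewrite -mulrDr ler_wpM2l // -natrD ler_nat size_filter_lt_gt.
Qed.

End BalancedPivot.

Lemma work_bound0 {R : realType} (p q : nat) :
  p = 0%N \/ q = 0%N -> work_bound p q = 0 :> R.
Proof. by case=> ->; rewrite /work_bound ?min0n ?minn0 mul0r. Qed.

(** The rate [(11/10)^2 = 1.21] is common to the AVL, red-black and weight-balanced schemes, so one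
    constant serves all three. *)
Lemma balanced_split_work (R : realType) : exists c : R,
  forall (op : set_operation) (A : Type) (d : Order.disp_t) (K : orderType d)
    (join : tree A K -> K -> tree A K -> tree A K)
    (balanced : tree A K -> bool),
    (forall L m T, inorder (join L m T) = inorder L ++ m :: inorder T) ->
    (forall L a k T, balanced (Node L a k T) -> balanced L /\ balanced T) ->
    (forall T, balanced T ->
       (11 / 10) ^+ 2 ^+ height T <= (weight T)%:R :> R) ->
  forall Tp Td : tree A K, bst Td -> balanced Tp ->
    split_work op join Td Tp <= c * work_bound (tree_size Tp) (tree_size Td).
Proof.
(* Layers are measured by the weight [p + 1], which is at most [2 * p]. *)
have [c [c0 Hc]] := layered_work_bound R; exists (2 * c).
move=> op A d K join bal joinE bal_sub bal_w Tp Td bTd balTp.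
rewrite split_work_node_sum // -(size_inorder Td).
have [p0|p0] := posnP (tree_size Tp).
  by rewrite work_bound0 ?mulr0; [case: Tp p0 {balTp} | left].
have [q0|q0] := posnP (size (inorder Td)).
  rewrite work_bound0 ?mulr0; last by right.
  by rewrite (size0nil q0) node_sum_nil.
have [a [b [a0 b0 hab hsum]]] := Hc _ _ p0 q0.
apply: le_trans (_ : node_sum (fun h _ n => a h + b h * n%:R) Tp (inorder Td)
    <= _).
  by apply: ler_node_sum => h _ n; apply: hab.
have g0 : 0 < (11 / 10 : R) ^+ 2 by rewrite exprn_gt0 //; lra.
apply: le_trans (node_sum_height_le _ _ g0 bal_sub bal_w a b _ _ a0 b0 balTp) _.
rewrite -mulrA; apply: le_trans (ler_wpM2l _ (hsum (height Tp).+1)) => //.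
rewrite mulr_sumr; apply: ler_sum => i _; rewrite mulrDr; apply: lerD.
  rewrite mulrA ler_pM2r ?invr_gt0 ?exprn_gt0 // mulrCA ler_wpM2l //.
  by rewrite -natrM ler_nat /weight; lia.
by rewrite ler_peMl ?mulr_ge0 // ler1n.
Qed.

(** * Exponential weight of AVL, red-black and weight-balanced trees *)

Lemma avl_weight {R : realType} {K : Type} (T : tree unit K) : avl T ->
  (11 / 10) ^+ 2 ^+ height T <= (weight T)%:R :> R.
Proof.
set g : R := (11 / 10) ^+ 2.
have gE : g = 121 / 100 by rewrite /g; lra.
have g0 n : 0 < g ^+ n by rewrite exprn_gt0 // gE; lra.
have mono m n : (m <= n)%N -> g ^+ m <= g ^+ n.
  by move=> mn; rewrite ler_weXn2l // gE; lra.
elim: T => [|L IHL u k T IHT] /=; first by rewrite expr0 /weight.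
case/and4P=> hLR hRL /IHL{}IHL /IHT{}IHT.
rewrite weight_node natrD.
(* The shorter child is at most one level lower, so the Fibonacci-type condition [g ^+ 2 <= g + 1]
   suffices, and 1.21 satisfies it. *)
have [le|lt] := leqP (height T) (height L).
  rewrite exprS; have := mono _ _ hLR; rewrite exprS => h.
  have := g0 (height T); rewrite gE in IHL IHT h *; nra.
rewrite exprS; have := mono _ _ hRL; rewrite exprS => h.
have := g0 (height L); rewrite gE in IHL IHT h *; nra.
Qed.

Lemma constant_all_pred1 {T : eqType} (x0 : T) (s : seq T) :
  constant s -> exists x, all (pred1 x) s.
Proof. by case: s => [|x s] cs; [exists x0 | exists x; rewrite /= eqxx]. Qed.

Lemma black_counts_node {K : Type} (L : tree color K) (c : color) (k : K)
    (T : tree color K) (b : nat) :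
  all (pred1 b) (black_counts (Node L c k T)) ->
  all (pred1 (b - ~~ is_red_color c)%N) (black_counts L) /\
  all (pred1 (b - ~~ is_red_color c)%N) (black_counts T).
Proof.
rewrite /= all_map all_cat => /andP[/allP hL /allP hT].
by split; apply/allP => n; [move/hL | move/hT] => /eqP /= <-; rewrite addKn.
Qed.

Lemma red_black_children {K : Type} (L : tree color K) (c : color) (k : K)
    (T : tree color K) :
  red_black (Node L c k T) -> red_black L /\ red_black T.
Proof.
case/andP=> /and3P[_ nL nT] /(constant_all_pred1 0%N)[b h].
have [/all_pred1_constant cL /all_pred1_constant cT] :=
  black_counts_node _ _ _ _ _ h.
by split; apply/andP.
Qed.

(** [b] includes the black leaf, so each path has [b.-1] black nodes. The terms [is_red T]
    strengthen the induction: a red root has two black children with the same count, hence one more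
    doubling and one more level. *)
Lemma red_black_size_height {K : Type} (T : tree color K) (b : nat) :
  no_red_red T -> all (pred1 b) (black_counts T) ->
  [/\ (0 < b)%N, (2 ^ (b.-1 + is_red T) <= weight T)%N
    & (height T <= b.-1.*2 + is_red T)%N].
Proof.
elim: T b => [|L IHL c k T IHT] b; first by move=> _ /= /andP[/eqP <-].
move=> /and3P[hc nL nT] hb; have [cL cT] := black_counts_node _ _ _ _ _ hb.
have [bL wL hL] := IHL _ nL cL; have [bT wT hT] := IHT _ nT cT.
rewrite weight_node; case: c {hb cL cT} hc bL wL hL bT wT hT => /=.
  move=> /andP[/negbTE-> /negbTE->]; rewrite !subn0 !addn0 addn1 expnS.
  by move=> bL wL hL bT wT hT; split; lia.
move=> _; rewrite addn0 => bL wL hL bT wT hT.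
have e : b.-1 = (b - 1).-1.+1 by lia.
rewrite e expnS; rewrite !expnD in wL wT.
have h (x : bool) : (1 <= 2 ^ x)%N by case: x.
have := h (is_red L); have := h (is_red T).
have := leq_b1 (is_red L); have := leq_b1 (is_red T).
by split; [lia | nia | lia].
Qed.

(** The height is at most twice the exponent of 2 in the weight bound, and [1.21 ^+ 2 <= 2]. *)
Lemma red_black_weight {R : realType} {K : Type} (T : tree color K) :
  red_black T -> (11 / 10) ^+ 2 ^+ height T <= (weight T)%:R :> R.
Proof.
case/andP=> nT /(constant_all_pred1 0%N)[b hb].
have [_ w h] := red_black_size_height _ _ nT hb.
set g : R := (11 / 10) ^+ 2.
have gE : g = 121 / 100 by rewrite /g; lra.
apply: (@le_trans _ _ (2 ^ (b.-1 + is_red T))%:R); last by rewrite ler_nat.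
apply: (@le_trans _ _ (g ^+ (2 * (b.-1 + is_red T)))).
  by rewrite ler_weXn2l //; [rewrite gE; lra | lia].
rewrite exprM natrX lerXn2r // ?nnegrE ?exprn_ge0 // gE; lra.
Qed.

(** Each child has at most the fraction [1 - alpha < 9/11] of the weight, and [11/9 > 1.21]. *)
Lemma wb_weight {R : realType} {K : Type} (alpha : R) (T : tree unit K) :
  2 / 11 < alpha -> weight_balanced alpha T ->
  (11 / 10) ^+ 2 ^+ height T <= (weight T)%:R :> R.
Proof.
move=> alpha_gt; set g : R := (11 / 10) ^+ 2.
have gE : g = 121 / 100 by rewrite /g; lra.
elim: T => [|L IHL u k T IHT]; first by rewrite /= expr0 /weight.
rewrite [weight_balanced _ _]/=; case/and3P=> wL /IHL{}IHL /IHT{}IHT.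
have w0 (S : tree unit K) : 0 < (weight S)%:R :> R by rewrite ltr0n.
move: wL; rewrite ler_pdivlMr // ler_pdivrMr //.
rewrite weight_node natrD => /andP[lo hi].
have := w0 L; have := w0 T => wT wL.
rewrite /= exprS; case: (leqP (height L) (height T)) => _; rewrite gE in IHL IHT *; nra.
Qed.

(** * Treaps: heap order and keys between two keys *)

Section Treaps.
Local Open Scope classical_set_scope.

(* [x], which need not be in [ks], counts as sitting just before an equal key. *)
Definition between {d : Order.disp_t} {K : orderType d} (ks : seq K) (k x : K) :
    seq K :=
  [seq y <- ks | (k < y < x)%O || (x <= y < k)%O].

(* If [x] is among the keys decomposed at the node [k], then the keys of the
   pivot tree between [k] and [x] lie in the subtree rooted at [k]. *)
Lemma node_sum_heap_le {R : realType} {d : Order.disp_t} {K : orderType d}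
    (prio : K -> R) (a b : K -> R) (T : tree unit K) (s : seq K) :
  (forall k, 0 <= a k) -> (forall k, 0 <= b k) ->
  bst T -> heap_ordered prio T ->
  node_sum (fun _ k n => a k + b k * n%:R) T s <=
  \sum_(k <- inorder T) (a k + b k *
    \sum_(x <- s)
      (all (fun y => prio y <= prio k) (between (inorder T) k x))%:R).
Proof.
move=> a0 b0; elim: T s => [|L IHL c k T IHT] s bstT; first by rewrite big_nil.
have [bL bT ltL gtT] := sorted_node _ _ _ _ bstT.
case/and3P=> /allP hk hL hT; rewrite [node_sum _ _ _]/= [inorder _]/=.
set ks := inorder L ++ k :: inorder T.
rewrite big_cat big_cons /= addrCA; apply: lerD.
  case: ifP => _; first by rewrite addr_ge0 ?mulr_ge0 ?sumr_ge0.
  rewrite lerD2l ler_wpM2l //.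
  rewrite (eq_bigr (fun=> 1)) => [|x _]; last first.
    suff -> : all (fun y => prio y <= prio k) (between ks k x) by [].
    apply/allP => y; rewrite mem_filter => /andP[yk yks].
    apply: hk; move: yks; rewrite /ks !mem_cat inE.
    by case: eqP yk => [->|//]; rewrite !ltxx andbF.
  by rewrite big_const_seq count_predT iter_addr_0.
(* For a child [U] and keys [x] on its side of the root, neither the root nor a key of the other
   child lies between [x] and a key of [U]. *)
have sub (U : tree unit K) (P : pred K) :
    (forall s, node_sum (fun _ k n => a k + b k * n%:R) U s <=
      \sum_(k <- inorder U) (a k + b k * \sum_(x <- s)
        (all (fun y => prio y <= prio k) (between (inorder U) k x))%:R)) ->
    (forall k' x, k' \in inorder U -> P x ->
      between ks k' x = between (inorder U) k' x) ->
    node_sum (fun _ k n => a k + b k * n%:R) U [seq x <- s | P x] <=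
    \sum_(k <- inorder U) (a k + b k * \sum_(x <- s)
        (all (fun y => prio y <= prio k) (between ks k x))%:R).
  move=> IH eqb; apply: le_trans (IH _) _.
  rewrite !big_seq; apply: ler_sum => k' k'U; rewrite lerD2l ler_wpM2l //.
  rewrite big_filter big_mkcond /=; apply: ler_sum => x _.
  by case: ifP => // Px; rewrite eqb.
apply: lerD.
  apply: sub => // [s'|k' x /ltL k'k xk]; first exact: IHL.
  rewrite /between /ks filter_cat -[RHS]cats0; congr (_ ++ _).
  apply: filter_in_pred0 => y; rewrite inE => yT.
  have ky : (k <= y)%O by case/orP: yT => [/eqP->//|/gtT/ltW].
  rewrite negb_or !negb_and -!leNgt (le_trans (ltW xk) ky) orbT /=.
  by rewrite (le_trans (ltW k'k) ky).
apply: sub => // [s'|k' x /gtT kk' kx]; first exact: IHT.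
rewrite /between /ks -cat_rcons filter_cat -[RHS]cat0s; congr (_ ++ _).
apply: filter_in_pred0 => y; rewrite mem_rcons inE => yL.
have yk : (y <= k)%O by case/orP: yL => [/eqP->//|/ltL/ltW].
rewrite negb_or !negb_and -leNgt (le_trans yk (ltW kk')) /=.
by rewrite -ltNge (le_lt_trans yk kx).
Qed.

(** On either side of [x], the keys in order of distance have 0, 1, 2, ... keys between them and
    [x], so each side is a partial geometric series. *)
Lemma sum_geometric_between {R : realType} {d : Order.disp_t} {K : orderType d}
    (r : R) (ks : seq K) (x : K) : 0 <= r -> r < 1 -> sorted <%O ks ->
  \sum_(k <- ks) r ^+ size (between ks k x) <= 2 / (1 - r).
Proof.
move=> r0 r1; rewrite (sorted_pairwise lt_trans) => pks.
have inv0 : 0 < (1 - r)^-1 by rewrite invr_gt0; lra.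
have size_between s k : size (between s k x) = 
    (if (k < x)%O then count (fun y => (k < y < x)%O) s
     else count (fun y => (x <= y < k)%O) s).
  rewrite size_filter; case: ltP => kx; apply: eq_count => y /=.
    rewrite orbC; case: (leP x y) => //= xy; rewrite andbF orbF; apply/negbTE.
    by rewrite -leNgt (ltW (lt_le_trans kx xy)).
  case: (ltP y x) => //; last by rewrite andbF.
  by rewrite andbT => yx; rewrite orbF; apply/negbTE; rewrite -leNgt (le_trans (ltW yx)).
rewrite (bigID (fun k => (k < x)%O)) /=.
have above : \sum_(k <- ks | ~~ (k < x)%O) r ^+ size (between ks k x) <=
    (1 - r)^-1.
  under eq_bigr => k /negbTE kx do rewrite size_between kx.
  elim: ks pks => [|k s IH] /=; first by rewrite big_nil ltW.
  case/andP=> /allP gtk /IH{}IH; rewrite big_cons -leNgt.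
  case: (leP x k) => [xk|kx] /=; last first.
    by [].
  rewrite ltxx add0n.
  have -> : count (fun y => (x <= y < k)%O) s = 0%N.
    apply/eqP; rewrite -leqn0 leqNgt -has_count; apply/hasPn => y /gtk ky.
    by rewrite negb_and -!leNgt (ltW ky) orbT.
  rewrite expr0 big_seq_cond.
  under eq_bigr => y /andP[/gtk ky _] do rewrite ky add1n exprS.
  rewrite -big_seq_cond -mulr_sumr.
  have e : (1 - r)^-1 = 1 + r * (1 - r)^-1 by field; lra.
  by rewrite e lerD2l ler_wpM2l.
have below : \sum_(k <- ks | (k < x)%O) r ^+ size (between ks k x) <=
    (1 - r)^-1.
  under eq_bigr => k kx do rewrite size_between kx.
  (* Here the head of the list is the key farthest from [x] and carries the largest exponent, so the
     induction needs the exact partial sum. *)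
  suff h : \sum_(k <- ks | (k < x)%O) r ^+ count (fun y => (k < y < x)%O) ks <=
      (1 - r ^+ count (fun y => (y < x)%O) ks) * (1 - r)^-1.
    by apply: le_trans h _; rewrite ger_pMl // gerBl exprn_ge0.
  elim: ks pks {above} => [|k s IH] /=; first by rewrite big_nil expr0 subrr mul0r.
  case/andP=> /allP gtk /IH{}IH; rewrite big_cons.
  have nk : \sum_(j <- s | (j < x)%O) 
       r ^+ ((j < k < x)%O + count (fun y => (j < y < x)%O) s) =
     \sum_(j <- s | (j < x)%O) r ^+ (count (fun y => (j < y < x)%O) s).
    rewrite big_seq_cond [RHS]big_seq_cond; apply: eq_bigr => j /andP[/gtk kj _].
    by rewrite ltNge (ltW kj).
  rewrite nk; case: (ltP k x) => kx /=; last by rewrite add0n.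
  rewrite ltxx add0n add1n exprS.
  have -> : count (fun y => (k < y < x)%O) s = count (fun y => (y < x)%O) s.
    by apply: eq_in_count => y /gtk ky /=; rewrite ky.
  have e y : (1 - r * y) * (1 - r)^-1 = y + (1 - y) * (1 - r)^-1 by field; lra.
  by rewrite e lerD2l.
by rewrite -[2]/(1 + 1) mulrDl mul1r; apply: lerD.
Qed.

(** * Expectations, uniform priorities and their layers *)

Lemma ge0_expectation_le {R : realType} {d : measure_display}
    {Omega : measurableType d} (P : probability Omega R) (f g : Omega -> R) :
  (forall w, 0 <= f w) -> (forall w, f w <= g w) -> ('E_P[f] <= 'E_P[g])%E.
Proof.
move=> f0 fg; rewrite unlock !ge0_integralTE; last 2 first.
- by move=> w; rewrite lee_fin (le_trans (f0 w)).
- by move=> w; rewrite lee_fin.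
(* The integral is a supremum over simple functions below the integrand, and those below [f] are
   below [g]. *)
apply: le_ereal_sup => _ [h hf <-]; exists h => //.
by move=> w; rewrite (le_trans (hf w)) // lee_fin.
Qed.

Lemma expectation_sum_indic {R : realType} {d : measure_display}
    {Omega : measurableType d} (P : probability Omega R) (I : Type)
    (s : seq I) (c : I -> R) (E : I -> set Omega) :
  (forall i, 0 <= c i) -> (forall i, measurable (E i)) ->
  ('E_P[fun w => (\sum_(i <- s) c i * \1_(E i) w)%R])%E =
  (\sum_(i <- s) c i * fine (P (E i)))%:E.
Proof.
move=> c0 mE; rewrite unlock.
under eq_integral do rewrite -sumEFin.
rewrite ge0_integral_sum //; last 2 first.
- move=> i; apply/measurable_EFinP; apply: measurable_funM => //.
- by move=> i w _; rewrite lee_fin mulr_ge0.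
rewrite -sumEFin; apply: eq_bigr => i _.
under eq_integral do rewrite EFinM.
rewrite ge0_integralZl_EFin //; last first.
  exact/measurable_EFinP/measurable_indic.
by rewrite integral_indic // setIT EFinM fineK // fin_num_measure.
Qed.

Lemma uniform_prob_le {R : realType} (U : set R) (a b : R) : measurable U ->
  a <= b -> U `&` `[0, 1] `<=` `[a, b] ->
  (uniform_prob (@ltr01 R) U <= (b - a)%:E)%E.
Proof.
move=> mU ab Uab; rewrite /uniform_prob integral_uniform_pdf.
have mI : measurable (U `&` `[0, 1]) by exact: measurableI.
apply: (@le_trans _ _ (lebesgue_measure (U `&` `[0, 1]))).
  rewrite -[leRHS]mul1e -integral_cst //; apply: ge0_le_integral => //=.
  - by move=> x _; rewrite lee_fin uniform_pdf_ge0.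
  - by apply/measurable_EFinP/measurable_funTS; exact: measurable_uniform_pdf.
  - by move=> x [_]; rewrite /= in_itv/= /uniform_pdf => ->; rewrite subr0 invr1.
apply: (@le_trans _ _ (lebesgue_measure `[a, b])).
  by apply: le_measure => //; rewrite inE.
rewrite lebesgue_measure_itv /= lte_fin; case: ltP => // _.
by rewrite lee_fin subr_ge0.
Qed.

(* Layer [i <= H] consists of the priorities from [1 - 2^-i] up to
   [1 - 2^-(i+1)]; layers [0] and [H] are unbounded. *)
Definition above_layer {R : realType} (i : nat) (u : R) : bool :=
  (i == 0%N) || (1 - 2^-1 ^+ i <= u).

Definition below_layer {R : realType} (H i : nat) (u : R) : bool :=
  (i == H) || (u < 1 - 2^-1 ^+ i.+1).

(** Raising [H] by one cuts the unbounded last layer in two. *)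
Lemma layer_ex {R : realType} (H : nat) (u : R) :
  exists i : 'I_H.+1, above_layer i u && below_layer H i u.
Proof.
elim: H => [|H [i /andP[lo hi]]]; first by exists ord0.
have [iH|iH] := eqVneq (i : nat) H; last first.
  exists (widen_ord (leqnSn _) i) => /=; rewrite lo /below_layer.
  by move: hi; rewrite /below_layer (negbTE iH) /= => ->; rewrite orbT.
have [h|h] := ltP u (1 - 2^-1 ^+ H.+1); last first.
  by exists ord_max; rewrite /above_layer /below_layer /= eqxx h.
exists (widen_ord (leqnSn _) i) => /=; rewrite lo /below_layer iH h orbT //.
Qed.

Lemma below_layer_le {R : realType} (H i : nat) (u v : R) :
  v <= u -> below_layer H i u -> below_layer H i v.
Proof.
move=> vu /orP[iH|ui]; first by rewrite /below_layer iH.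
by rewrite /below_layer (le_lt_trans vu ui) orbT.
Qed.

Lemma half_exp_le1 {R : realType} (i : nat) : 2^-1 ^+ i <= 1 :> R.
Proof. by rewrite exprn_ile1 //; lra. Qed.

Lemma measurable_above_layer {R : realType} (i : nat) :
  measurable [set u : R | above_layer i u].
Proof.
rewrite /above_layer; case: (i == 0%N) => /=; first by rewrite set_true.
by rewrite -[X in measurable X]set_itvcy.
Qed.

Lemma measurable_below_layer {R : realType} (H i : nat) :
  measurable [set u : R | below_layer H i u].
Proof.
rewrite /below_layer; case: (i == H) => /=; first by rewrite set_true.
by rewrite -[X in measurable X]set_itvNyo.
Qed.

Lemma uniform_above_layer {R : realType} (i : nat) :
  (uniform_prob (@ltr01 R) [set u | above_layer i u] <= (2^-1 ^+ i)%:E)%E.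
Proof.
have := @half_exp_le1 R i => h; have h0 : 0 <= 2^-1 ^+ i :> R by rewrite exprn_ge0.
have -> : 2^-1 ^+ i = 1 - (1 - 2^-1 ^+ i) :> R by lra.
apply: uniform_prob_le; [exact: measurable_above_layer | lra |].
move=> u [/= + ]; rewrite !in_itv /= => + /andP[u0 u1].
by rewrite u1 andbT; case/orP => [/eqP-> |//]; rewrite expr0 subrr.
Qed.

Lemma uniform_below_layer {R : realType} (H i : nat) :
  (uniform_prob (@ltr01 R) [set u | below_layer H i u] <=
   (if i == H then 1 else 1 - 2^-1 ^+ i.+1)%:E)%E.
Proof.
have := @half_exp_le1 R i.+1 => h.
set t := (X in (_ <= X%:E)%E); have t0 : 0 <= t by rewrite /t; case: ifP => _; lra.
rewrite -[t]subr0; apply: uniform_prob_le => //.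
  exact: measurable_below_layer.
move=> u [/= + ]; rewrite !in_itv /= => + /andP[u0 u1].
by rewrite u0 /below_layer /t; case: (i == H) => //= /ltW.
Qed.

(** Contains the event that [k] lies in layer [i] and no key of [s] has higher priority. Comparing
    with fixed thresholds instead of the priority of [k] makes it an intersection of conditions on
    single keys. *)
Definition chain_event {R : realType} {d : measure_display}
    {Omega : measurableType d} {K : eqType} {P : probability Omega R}
    (prio : K -> {RV P >-> R}) (H i : nat) (k : K) (s : seq K) : set Omega :=
  [set w | above_layer i (prio k w) &&
           all (fun y => below_layer H i (prio y w)) s].

Section ChainEvent.
Context {R : realType} {d : measure_display} {Omega : measurableType d}.
Context {K : eqType} {P : probability Omega R}.
Variables (prio : K -> {RV P >-> R}) (H i : nat).

Lemma measurable_preimage_prio (k : K) (B : set R) :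
  measurable B -> measurable (prio k @^-1` B).
Proof. by move=> mB; rewrite -[X in measurable X]setTI; exact: measurable_funP. Qed.

Lemma measurable_chain_event (k : K) (s : seq K) :
  measurable (chain_event prio H i k s).
Proof.
have -> : chain_event prio H i k s =
    (prio k @^-1` [set u | above_layer i u]) `&`
    [set w | all (fun y => below_layer H i (prio y w)) s].
  by apply/seteqP; split => w /= /andP.
apply: measurableI.
  by apply: measurable_preimage_prio; exact: measurable_above_layer.
elim: s => [|y s IH] /=; first by rewrite set_true.
have -> : [set w | below_layer H i (prio y w) &&
      all (fun y => below_layer H i (prio y w)) s] =
    (prio y @^-1` [set u | below_layer H i u]) `&`
    [set w | all (fun y => below_layer H i (prio y w)) s].
  by apply/seteqP; split => w /= /andP.
apply: measurableI => //.
by apply: measurable_preimage_prio; exact: measurable_below_layer.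
Qed.

(** As [k] is not in [s], each key carries one condition, and independence turns the probability
    into a product. *)
Lemma chain_event_prob_le (ks : seq K) (k : K) (s : seq K) :
  iid_uniform_priorities ks prio -> uniq (k :: s) ->
  {subset k :: s <= ks} ->
  fine (P (chain_event prio H i k s)) <=
  2^-1 ^+ i * (if i == H then 1 else 1 - 2^-1 ^+ i.+1) ^+ size s.
Proof.
move=> [unif indep] uks sub; have /andP[ks_ us] := uks.
pose B y := if y == k then [set u : R | above_layer i u]
            else [set u | below_layer H i u].
have mB y : measurable (B y).
  rewrite /B; case: ifP => _; first exact: measurable_above_layer.
  exact: measurable_below_layer.
have -> : chain_event prio H i k s =
    \bigcap_(y in [set` k :: s]) (prio y @^-1` B y).
  apply/seteqP; split => w /=.
    move=> /andP[lo /allP hi] y /=; rewrite /B inE; case: eqP => [->//|_] /= ys.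
    exact: hi.
  move=> h; apply/andP; split.
    by have := h k; rewrite /B /= mem_head eqxx; apply.
  apply/allP => y ys; have := h y; rewrite /B /= inE ys orbT.
  case: eqP => [yk|_]; last by apply.
  by move: ks_; rewrite -yk ys.
rewrite (indep _ B) //= big_cons.
have probE y : y \in ks -> P (prio y @^-1` B y) = uniform_prob (@ltr01 R) (B y).
  by move=> yks; exact: unif.
have fin y : P (prio y @^-1` B y) \is a fin_num.
  by apply: fin_num_measure; exact: measurable_preimage_prio.
apply: ler_pM; [exact: fine_ge0 | by apply: prodr_ge0 => y _; exact: fine_ge0 | |].
  rewrite -lee_fin fineK // probE ?sub ?mem_head // /B eqxx.
  exact: uniform_above_layer.
set r := (if _ then _ else _).
have -> : r ^+ size s = \prod_(y <- s) r.
  by rewrite big_const_seq count_predT iter_mulr_1.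
rewrite !big_seq; apply: ler_prod => y ys; rewrite fine_ge0 //=.
have yk : (y == k) = false by apply: contraNF ks_ => /eqP <-.
rewrite -lee_fin fineK // probE ?sub ?inE ?ys ?orbT // /B yk.
exact: uniform_below_layer.
Qed.

End ChainEvent.

(** * Expected split work for treaps *)

Lemma treap_split_work (R : realType) : exists c : R,
  forall (op : set_operation) (d : Order.disp_t) (K : orderType d)
    (d' : measure_display) (Omega : measurableType d')
    (P : probability Omega R) (prio : K -> {RV P >-> R})
    (kp kd : seq K) (Tp Td : Omega -> tree unit K),
    iid_uniform_priorities (kp ++ kd) prio ->
    random_treap kp prio Tp -> random_treap kd prio Td ->
    ('E_P[fun w : Omega =>
            split_work op (treap_join (prio ^~ w)) (Td w) (Tp w)]
       <= (c * work_bound (size kp) (size kd))%:E)%E.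
Proof.
(* 4 is [2^-i * 2 / 2^-(i+1)], the bound on the expected number of calls in layer [i] charged with a
   given key. *)
have [c [c0 Hc]] := layered_work_bound R; exists (4 * c).
move=> op d K d' Omega P prio kp kd Tp Td iid [_ tp] [_ td].
under eq_fun => w.
  rewrite split_work_node_sum; last 2 first.
  - exact: inorder_treap_join.
  - by have [] := td w.
  have [_ -> _] := td w.
  over.
have Ezero : (forall w, node_sum (fun _ _ n => log2 (n%:R + 1) + 1) (Tp w) kd
      = 0 :> R) -> work_bound (size kp) (size kd) = 0 :> R ->
    ('E_P[fun w => node_sum (fun _ _ n => (log2 (n%:R + 1) + 1)%R) (Tp w) kd] <=
     (4 * c * work_bound (size kp) (size kd))%:E)%E.
  move=> f0 ->; rewrite mulr0.
  under eq_fun do rewrite f0.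
  by rewrite expectation_cst.
have [p0|p0] := posnP (size kp).
  apply: Ezero => [w|]; last by apply: work_bound0; left.
  have [_ + _] := tp w; rewrite (size0nil p0); case: (Tp w) => //= L u k T.
  by case: (inorder L).
have [q0|q0] := posnP (size kd).
  apply: Ezero => [w|]; last by apply: work_bound0; right.
  by rewrite (size0nil q0) node_sum_nil.
(* The order of [kp] is read off the treap at some outcome; one exists because [P] has total mass
   1. *)
have kp_sorted : sorted <%O kp.
  have [w0 _] : exists w0 : Omega, True.
    apply: contrapT => noW; have : P setT = 1%E by exact: probability_setT.
    have -> : [set: Omega] = set0.
      by apply/seteqP; split => // w _; case: noW; exists w.
    by rewrite measure0 => /esym/eqP; rewrite onee_eq0.
  by have [bT <- _] := tp w0.
have kp_uniq : uniq kp by exact: lt_sorted_uniq kp_sorted.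
have [a [b [a0 b0 hab hsum]]] := Hc _ _ p0 q0.
(* The last layer has no upper threshold, so the keys in between give no decay there. With this [H],
   the sum of [2^-H] over [kp] is still at most 1. *)
set H := size kp.
(* The index [(k, i, None)] stands for the constant cost of a call at [k] in layer [i], and
   [(k, i, Some x)] for the share of the key [x] in it. *)
pose S (ko : option K) (k : K) := if ko is Some x then between kp k x else [::].
pose idx := [seq (ki, o) | ki <- [seq (k, i) | k <- kp, i <- enum 'I_H.+1],
                           o <- None :: [seq Some x | x <- kd]].
pose coef (j : K * 'I_H.+1 * option K) : R := if j.2 is Some _ then b j.1.2 else a j.1.2.
have coef0 j : 0 <= coef j by rewrite /coef; case: j.2.
pose ev (j : K * 'I_H.+1 * option K) := chain_event prio H j.1.2 j.1.1 (S j.2 j.1.1).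
have sum_idx (F : K * 'I_H.+1 * option K -> R) : \sum_(j <- idx) F j =
    \sum_(i < H.+1) \sum_(k <- kp) (F (k, i, None) + \sum_(x <- kd) F (k, i, Some x)).
  rewrite /idx !big_allpairs exchange_big /= big_enum /=.
  by apply: eq_bigr => i _; apply: eq_bigr => k _; rewrite big_cons big_map.
apply: (@le_trans _ _ 'E_P[fun w => (\sum_(j <- idx) coef j * \1_(ev j) w)%R]%E).
  apply: ge0_expectation_le => w.
    apply: le_trans (ler_node_sum (fun _ _ _ => 0) _ _ _ _) => [|_ _ n _].
      by elim: (Tp w) kd {tp td iid sum_idx idx Ezero q0 hsum} => //= L IHL u k T IHT s;
        rewrite if_same add0r addr_ge0.
    by rewrite addr_ge0 // log2_ge0 // lerDr.
  have [bT iT hT] := tp w.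
  pose rk (u : R) : 'I_H.+1 := xchoose (layer_ex H u).
  have h1 : node_sum (fun _ _ n => log2 (n%:R + 1) + 1) (Tp w) kd <=
      node_sum (fun _ k n => a (rk (prio k w)) + b (rk (prio k w)) * n%:R)
        (Tp w) kd.
    by apply: ler_node_sum => h k n; exact: hab.
  refine (le_trans h1 _).
  apply: le_trans (node_sum_heap_le (prio ^~ w) _ _ _ _ _ _ bT hT) _ => //.
  rewrite iT sum_idx exchange_big /=; apply: ler_sum => k _.
  set i := rk _; have /andP[lo hi] := xchooseP (layer_ex H (prio k w)).
  rewrite -/(rk _) -/i in lo hi.
  (* [k] is charged to its own layer; the other layers only add nonnegative terms. *)
  rewrite (bigD1 i) //= -[leLHS]addr0; apply: lerD; last first.
    apply: sumr_ge0 => j _; rewrite addr_ge0 ?mulr_ge0 //.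
    by apply: sumr_ge0 => x _; rewrite mulr_ge0.
  rewrite /coef /=; apply: lerD.
    by rewrite ler_peMr // indicE mem_set // /ev /chain_event /= lo.
  rewrite mulr_sumr; apply: ler_sum => x _; rewrite ler_wpM2l //.
  (* Keys dominated by [k] stay below the upper threshold of its layer, so the chain event
     occurs. *)
  case: allP => // le_k; rewrite indicE mem_set // /ev /chain_event /= lo /=.
  by apply/allP => y /le_k yk; exact: below_layer_le hi.
rewrite expectation_sum_indic //; last by move=> j; exact: measurable_chain_event.
rewrite lee_fin sum_idx -mulrA.
apply: le_trans (ler_wpM2l _ (hsum H.+1)) => //; rewrite mulr_sumr.
apply: ler_sum => i _; rewrite big_split /coef /ev /= mulrDr; apply: lerD.
  rewrite -mulr_sumr -[a i * _ / _]mulrA mulrCA ler_wpM2l //.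
  apply: le_trans (_ : \sum_(k <- kp) 2^-1 ^+ i <= _).
    rewrite !big_seq; apply: ler_sum => k kkp.
    have := chain_event_prob_le prio H i (kp ++ kd) k [::] iid.
    rewrite expr0 mulr1; apply => // y; rewrite inE => /eqP ->.
    by rewrite mem_cat kkp.
  rewrite big_const_seq count_predT iter_addr_0 -[_ *+ size kp]mulr_natl.
  rewrite [leRHS]mulrCA.
  (* The fraction [2^-i] is at most the [(11/10)^(-2i)] of the layered bound. *)
  rewrite ler_wpM2l // -[leLHS]mul1r ler_pM ?ler1n ?exprn_ge0 //.
  rewrite -exprVn lerXn2r // ?nnegrE ?invr_ge0 ?exprn_ge0 //; lra.
rewrite exchange_big /= mulrCA mulrA [b i * 4]mulrC -mulrA.
apply: le_trans (_ : \sum_(x <- kd) b i * 4 <= _); last first.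
  by rewrite big_const_seq count_predT iter_addr_0 -mulr_natr; lra.
apply: ler_sum => x _; rewrite -mulr_sumr ler_wpM2l //.
pose r : R := if i == H :> nat then 1 else 1 - 2^-1 ^+ i.+1.
apply: le_trans (_ : \sum_(k <- kp) 2^-1 ^+ i * r ^+ size (between kp k x) <= _).
  rewrite !big_seq; apply: ler_sum => k kkp.
  apply: (chain_event_prob_le prio H i (kp ++ kd) k (between kp k x) iid).
    rewrite /= filter_uniq // andbT mem_filter !ltxx andbF //.
  move=> y; rewrite inE mem_cat => /orP[/eqP->|]; first by rewrite kkp.
  by rewrite mem_filter => /andP[_ ->].
have half0 n : 0 < 2^-1 ^+ n :> R by rewrite exprn_gt0.
rewrite -mulr_sumr /r; case: eqP => [->|_].
  rewrite (eq_bigr (fun=> 1)) => [|k _]; last by rewrite expr1n.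
  rewrite big_const_seq count_predT iter_addr_0 -/H.
  apply: (@le_trans _ _ 1); last by lra.
  by rewrite exprVn mulrC ler_pdivrMr ?exprn_gt0 // mul1r -natrX ler_nat ltnW // ltn_expl.
have r0 : 0 <= 1 - 2^-1 ^+ i.+1 :> R by rewrite subr_ge0 half_exp_le1.
have r1 : 1 - 2^-1 ^+ i.+1 < 1 :> R by rewrite ltrBlDr ltrDl.
have h3 := half0 i.
have := sum_geometric_between _ kp x r0 r1 kp_sorted.
move=> /(ler_wpM2l (ltW h3)) /le_trans; apply.
have -> : 1 - (1 - 2^-1 ^+ i.+1) = 2^-1 * 2^-1 ^+ i :> R by rewrite exprS; ring.
by rewrite le_eqVlt; apply/orP; left; apply/eqP; field; rewrite gt_eqF.
Qed.

End Treaps.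

(** * The bound for the four balancing schemes *)

Theorem theorem6 (R : realType) (op : set_operation) :
  (* AVL trees *)
  [/\ exists c : R,
        forall (d : Order.disp_t) (K : orderType d) (Tp Td : tree unit K),
          bst Tp -> bst Td -> avl Tp -> avl Td ->
          split_work op avl_join Td Tp <= c * work_bound (tree_size Tp) (tree_size Td),
  (* red-black trees *)
      exists c : R,
        forall (d : Order.disp_t) (K : orderType d) (Tp Td : tree color K),
          bst Tp -> bst Td -> red_black Tp -> red_black Td ->
          split_work op rb_join Td Tp <= c * work_bound (tree_size Tp) (tree_size Td),
  (* weight-balanced trees *)
      forall alpha : R, 2 / 11 < alpha -> alpha <= 1 - 1 / Num.sqrt 2 ->
      exists c : R,
        forall (d : Order.disp_t) (K : orderType d) (Tp Td : tree unit K),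
          bst Tp -> bst Td ->
          weight_balanced alpha Tp -> weight_balanced alpha Td ->
          split_work op (wb_join alpha) Td Tp
            <= c * work_bound (tree_size Tp) (tree_size Td) &
  (* treaps *)
      exists c : R,
        forall (d : Order.disp_t) (K : orderType d)
          (d' : measure_display) (Omega : measurableType d')
          (P : probability Omega R) (prio : K -> {RV P >-> R})
          (kp kd : seq K) (Tp Td : Omega -> tree unit K),
          iid_uniform_priorities (kp ++ kd) prio ->
          random_treap kp prio Tp -> random_treap kd prio Td ->
          ('E_P[fun w : Omega =>
                  split_work op (treap_join (prio ^~ w)) (Td w) (Tp w)]
             <= (c * work_bound (size kp) (size kd))%:E)%E].
Proof.
have [c Hc] := balanced_split_work R; have [ct Hct] := treap_split_work R.
split.
- exists c => d K Tp Td _ bTd avlTp _.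
  apply: Hc avlTp => //; [exact: inorder_avl_join | | exact: avl_weight].
  by move=> L a k T /and4P[].
- exists c => d K Tp Td _ bTd rbTp _.
  apply: Hc rbTp => //; first exact: inorder_rb_join.
    exact: red_black_children.
  exact: red_black_weight.
- move=> alpha alpha_gt _; exists c => d K Tp Td _ bTd wbTp _.
  apply: Hc wbTp => //; first exact: inorder_wb_join.
    by move=> L a k T /and3P[].
  by move=> T; exact: wb_weight.
- exists ct => d K d' Omega P prio kp kd Tp Td iid tp td.
  exact: Hct iid tp td.
Qed.
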